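(* Let $\tilde P_1,\tilde P_2$ be non-deterministic random probability measures on $\mathbb{X}$, defined on the same probability space, with the same mean measure $\mathbb{E}[\tilde P_1]=\mathbb{E}[\tilde P_2]=P_0$. Suppose that for some $\eta\in[-1,1]$ and $\lambda_1,\lambda_2\in(0,1]$, $$\mathrm{Cov}\big(\tilde P_1(A),\tilde P_2(A)\big)=\eta\,P_0(A)(1-P_0(A)),\qquad \mathrm{Var}\big(\tilde P_i(A)\big)=\lambda_i\,P_0(A)(1-P_0(A))\quad(i=1,2)$$ for every $A\in\mathcal{X}$. Then for any injective kernel $k$ on $\mathbb{X}$ and any $A\in\mathcal{X}$ such that $\tilde P_i(A)$ is not deterministic for $i=1,2$, $$\mathrm{Corr}_k(\tilde P_1,\tilde P_2)=\mathrm{Corr}\big(\tilde P_1(A),\tilde P_2(A)\big)=\frac{\eta}{\sqrt{\lambda_1\lambda_2}}.$$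
   Context: $\mathbb{X}$ is a locally compact Polish space with Borel $\sigma$-algebra $\mathcal{X}$. $\mathcal{P}(\mathbb{X})$ is the set of probability measures on $\mathbb{X}$, with the $\sigma$-algebra generated by the evaluation maps $\xi\mapsto\xi(A)$, $A\in\mathcal{X}$. A kernel on $\mathbb{X}$ is a measurable function $k:\mathbb{X}\times\mathbb{X}\to\mathbb{R}$ that is bounded, symmetric and positive-definite ($\sum_{i,j=1}^m a_ia_jk(x_i,x_j)\ge 0$ for all $m$, $x_i\in\mathbb{X}$, $a_i\in\mathbb{R}$). It is injective if the feature map $x\mapsto k(x,\cdot)$ is injective. $\mathbb{H}_k$ is its reproducing kernel Hilbert space. The kernel mean embedding of $P\in\mathcal{P}(\mathbb{X})$ is $\mu_k(P)\in\mathbb{H}_k$, $\mu_k(P)(y)=\int k(x,y)\,dP(x)$; it satisfies $\langle\mu_k(P_1),\mu_k(P_2)\rangle_{\mathbb{H}_k}=\iint k\,dP_1\,dP_2$. A random probability $\tilde P$ is a random element of $\mathcal{P}(\mathbb{X})$; it is deterministic if $\tilde P=P$ a.s. for some fixed $P\in\mathcal{P}(\mathbb{X})$; its mean measure is $\mathbb{E}[\tilde P](A)=\mathbb{E}[\tilde P(A)]$. $\mathrm{Cov}_k(\tilde P_1,\tilde P_2)=\mathbb{E}\big[\langle\mu_k(\tilde P_1)-\mathbb{E}[\mu_k(\tilde P_1)],\mu_k(\tilde P_2)-\mathbb{E}[\mu_k(\tilde P_2)]\rangle_{\mathbb{H}_k}\big]$, where the expectation of an $\mathbb{H}_k$-valued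 random element $V$ is characterised by $\langle h,\mathbb{E}[V]\rangle=\mathbb{E}\langle h,V\rangle$ for all $h\in\mathbb{H}_k$. $\mathrm{Var}_k(\tilde P)=\mathrm{Cov}_k(\tilde P,\tilde P)$, and $\mathrm{Corr}_k(\tilde P_1,\tilde P_2)=\mathrm{Cov}_k(\tilde P_1,\tilde P_2)/\big(\sqrt{\mathrm{Var}_k(\tilde P_1)}\sqrt{\mathrm{Var}_k(\tilde P_2)}\big)$, defined when both kernel variances are positive (which is part of the conclusion here). $\mathrm{Corr}$, $\mathrm{Cov}$, $\mathrm{Var}$ without subscript are the usual ones for real random variables. *)

(* Defs.v *)
From HB Require Import structures.
From mathcomp Require Import all_boot all_order all_algebra.
From mathcomp Require Import all_classical all_reals all_analysis.
Set Implicit Arguments.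
Unset Strict Implicit.
Unset Printing Implicit Defensive.
Import Order.TTheory GRing.Theory Num.Theory.
Import numFieldNormedType.Exports.
Local Open Scope classical_set_scope.
Local Open Scope ring_scope.

Definition separable (T : topologicalType) : Prop :=
  exists2 D : set T, countable D & dense D.

(* The complete metric is not part of the data: only the topology of T is. *)
Definition completely_metrizable (R : realType) (T : topologicalType) : Prop :=
  exists (M : metricType R) (f : T -> M) (g : M -> T),
    [/\ cancel f g, cancel g f, continuous f, continuous g &
        forall F : set_system M, ProperFilter F -> cauchy F -> exists l : M, F --> l].

Definition polish (R : realType) (T : topologicalType) : Prop :=
  separable T /\ completely_metrizable R T.

(* Measurable types are pointed in the library; this loses nothing here, since
   a space carrying a probability measure is nonempty. *)
Definition borel (T : ptopologicalType) : measurableType (@open T).-sigma :=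
  g_sigma_algebraType (@open T).

Section RandomProbabilities.
Context (R : realType) (dO : measure_display) (Omega : measurableType dO)
  (d : measure_display) (X : measurableType d).

(* The sigma-algebra of [pprobability X R] is generated by the sets
   {xi | xi(A) < r}, that is, by the evaluation maps. *)
Definition random_probability := {mfun Omega >-> pprobability X R}.

Definition random_mass (Pt : random_probability) (A : set X) (w : Omega) : R :=
  fine ((Pt w : probability X R) A).

Definition mean_measure (P : probability Omega R) (Pt : random_probability)
    (A : set X) : \bar R :=
  'E_P[random_mass Pt A].

Definition deterministic_measure (P : probability Omega R)
    (Pt : random_probability) : Prop :=
  exists Q : probability X R,
    \forall w \ae P, forall A : set X, measurable A ->
      (Pt w : probability X R) A = Q A.

Definition deterministic_rv (P : probability Omega R) (Y : Omega -> R) : Prop :=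
  exists c : R, \forall w \ae P, Y w = c.

Definition correlation (P : probability Omega R) (Y Z : Omega -> R) : R :=
  fine (covariance P Y Z)
    / (Num.sqrt (fine 'V_P[Y]) * Num.sqrt (fine 'V_P[Z])).

End RandomProbabilities.

Section Kernels.
Context (R : realType) (d : measure_display) (X : measurableType d).

Definition is_kernel (k : X -> X -> R) : Prop :=
  [/\ measurable_fun [set: X * X] (fun z : X * X => k z.1 z.2),
      exists M : R, forall x y, `|k x y| <= M,
      forall x y, k x y = k y x &
      forall (m : nat) (x : 'I_m -> X) (a : 'I_m -> R),
        0 <= \sum_(i < m) \sum_(j < m) a i * a j * k (x i) (x j)].

(* The feature map sends x to the function k(x, .), i.e. it is k curried. *)
Definition injective_kernel (k : X -> X -> R) : Prop :=
  is_kernel k /\ injective k.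

End Kernels.

(* A Hilbert space of real functions on X that contains every k(x, .) and has
   the reproducing property.  Its elements are functions through the injective
   linear map [rkhs_fun].  Such a space is determined by k up to an isometry
   compatible with [rkhs_fun], and exists for every symmetric positive-definite
   k (Moore-Aronszajn). *)
Record rkhs (R : realType) (X : Type) (k : X -> X -> R) := Rkhs {
  rkhs_space :> completeNormedModType R;
  rkhs_dot : {dot rkhs_space for idfun};
  rkhs_normE : forall f : rkhs_space, `|f| ^+ 2 = rkhs_dot f f;
  rkhs_fun : rkhs_space -> X -> R;
  rkhs_fun_linear : forall (a : R) (f g : rkhs_space) (x : X),
    rkhs_fun (a *: f + g) x = a * rkhs_fun f x + rkhs_fun g x;
  rkhs_fun_inj : injective rkhs_fun;
  rkhs_feature : X -> rkhs_space;
  rkhs_featureE : forall x : X, rkhs_fun (rkhs_feature x) = k x;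
  rkhs_reproducing : forall (f : rkhs_space) (x : X),
    rkhs_dot f (rkhs_feature x) = rkhs_fun f x
}.

Section KernelMoments.
Context (R : realType) (d : measure_display) (X : measurableType d)
  (k : X -> X -> R) (H : rkhs k).
Context (dO : measure_display) (Omega : measurableType dO)
  (P : probability Omega R).

(* The default value 0 is irrelevant when k is a kernel: boundedness of k puts
   the function y |-> \int k(x, y) dQ(x) in H. *)
Definition mean_embedding (Q : probability X R) : H :=
  xget 0 [set m : H | forall y, rkhs_fun m y = \int[Q]_x k x y].

(* At most one m satisfies the condition; the default 0 is again irrelevant for
   the mean embedding of a random probability. *)
Definition hilbert_mean (V : Omega -> H) : H :=
  xget 0 [set m : H |
    forall h : H, ('E_P[fun w => rkhs_dot H h (V w)] = (rkhs_dot H h m)%:E)%E].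

Definition kernel_cov (Pt1 Pt2 : random_probability R Omega X) : R :=
  let V1 w := mean_embedding (Pt1 w) in
  let V2 w := mean_embedding (Pt2 w) in
  fine 'E_P[fun w => rkhs_dot H (V1 w - hilbert_mean V1)
                                (V2 w - hilbert_mean V2)].

Definition kernel_var (Pt : random_probability R Omega X) : R :=
  kernel_cov Pt Pt.

Definition kernel_corr (Pt1 Pt2 : random_probability R Omega X) : R :=
  kernel_cov Pt1 Pt2
    / (Num.sqrt (kernel_var Pt1) * Num.sqrt (kernel_var Pt2)).

End KernelMoments.

(* Main.v *)
Require Import Defs.
From HB Require Import structures.
From mathcomp Require Import all_boot all_order all_algebra.
From mathcomp Require Import all_classical all_reals all_analysis.
From mathcomp Require Import measurable_realfun giry ring lra.
Import Order.TTheory GRing.Theory Num.Theory.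
Import numFieldNormedType.Exports.
Local Open Scope classical_set_scope.
Local Open Scope ring_scope.
Set Implicit Arguments.
Unset Strict Implicit.
Unset Printing Implicit Defensive.

(* Only the masses of single sets are controlled, so the law of the pair enters
   through the symmetrised mean measure E[Pt1 x Pt2] + E[Pt2 x Pt1] on X * X.  On a
   square A x A it is 2 ((1 - eta) P0(A)^2 + eta P0(A)); by polarisation the same
   formula holds on rectangles, hence that measure is 2 ((1 - eta) P0 x P0 + eta D)
   with D the image of P0 on the diagonal.  Integrating the symmetric k gives
   Cov_k = eta S with S = \int k(x, x) dP0(x) - |mu(P0)|^2 = \int |k_x - mu(P0)|^2 dP0(x),
   and likewise Var_k(Pt_i) = lambda_i S.  If S = 0 then, k being injective, P0 is a
   point mass and the random probabilities are deterministic.  That mean embeddings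
   exist, and that the mean of mu(Pt) is mu(P0), comes from Riesz representation on
   the closed subspace of measurable elements of the RKHS. *)

(** * Riesz representation *)

Section Hilbert.
Context (R : realType) (V : completeNormedModType R) (dot : {dot V for idfun}).
Hypothesis normE : forall f : V, `|f| ^+ 2 = dot f f.

Lemma dotC (f g : V) : dot f g = dot g f.
Proof. by have := @hermitian_subproof _ _ _ _ dot f g; rewrite expr0 mul1r. Qed.

Lemma dotPl (a : R) (f g h : V) : dot (a *: f + g) h = a * dot f h + dot g h.
Proof. exact: linearPl. Qed.

Lemma dotPr (a : R) (f g h : V) : dot h (a *: f + g) = a * dot h f + dot h g.
Proof. by rewrite dotC dotPl !(dotC h). Qed.

Lemma dot0r (f : V) : dot f 0 = 0.
Proof. exact: linear0r. Qed.

Lemma dotBl (f g h : V) : dot (f - g) h = dot f h - dot g h.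
Proof. exact: linearBl. Qed.

Lemma dotBr (f g h : V) : dot h (f - g) = dot h f - dot h g.
Proof. exact: linearBr. Qed.

(** Cauchy-Schwarz: the squared norm of [dot g g *: f - dot f g *: g] is [dot g g] times the gap
    between the two sides; the factor is positive unless [g = 0]. *)
Lemma dot_sqr_le (f g : V) : dot f g ^+ 2 <= dot f f * dot g g.
Proof.
have := sqr_ge0 `|- dot f g *: g + dot g g *: f|.
rewrite normE.
have -> : dot (- dot f g *: g + dot g g *: f) (- dot f g *: g + dot g g *: f) =
  dot g g * (dot f f * dot g g - dot f g ^+ 2).
  rewrite dotPl dotPr -[_ *: f]addr0 !dotPr !dotPl (dotC 0) !dot0r
    (dotC 0) dot0r (dotC g f).
  ring.
have [->|g0] := eqVneq g 0; first by rewrite !dot0r mulr0 expr0n.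
have gg0 : 0 < dot g g by rewrite -normE exprn_gt0// normr_gt0.
by rewrite pmulr_rge0// subr_ge0.
Qed.

Lemma dot_norm_le (f g : V) : `|dot f g| <= `|f| * `|g|.
Proof.
rewrite -(@ler_pXn2r _ 2)// ?nnegrE ?mulr_ge0//.
by rewrite exprMn !normE real_normK ?num_real ?dot_sqr_le.
Qed.

Lemma cvg_dot (u : nat -> V) (l g : V) :
  u @ \oo --> l -> (dot (u n) g @[n --> \oo]) --> dot l g.
Proof.
move=> ul; apply/cvgrPdist_le => e e0.
have ge0 : 0 < e / (`|g| + 1) by rewrite divr_gt0// ltr_wpDl.
move/cvgrPdist_le : ul => /(_ _ ge0); apply: filterS => n lun.
rewrite -dotBl (le_trans (dot_norm_le _ _))//.
rewrite (le_trans (ler_wpM2r _ lun))//.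
by rewrite mulrAC ler_pdivrMr ?ltr_wpDl// ler_pM2l// lerDl.
Qed.

(* Riesz representation on a sequentially closed subspace [W]: the representer
   minimises [|f|^2 - 2 L f] on [W]. *)
Lemma riesz_subspace (W : set V) (L : V -> R) (c : R) :
    W 0 ->
    (forall (a : R) f g, W f -> W g -> W (a *: f + g)) ->
    (forall (u : nat -> V) l, (forall n, W (u n)) -> u @ \oo --> l -> W l) ->
    (forall (a : R) f g, W f -> W g -> L (a *: f + g) = a * L f + L g) ->
    (forall f, W f -> `|L f| <= c * `|f|) ->
  exists2 m, W m & forall g, W g -> dot m g = L g.
Proof.
move=> W0 Wlin Wcl Llin Lbd.
pose J f := dot f f - 2 * L f.
(* Completing the square: [J f] is at least [|f|^2 - 2 c |f|], that is [(|f| - c)^2 - c^2]. *)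
have Jlb f : W f -> - c ^+ 2 <= J f.
  move=> Wf; have := Lbd _ Wf; rewrite /J -normE => /(le_trans (ler_norm _)) h.
  by have := sqr_ge0 (`|f| - c); rewrite sqrrB; lra.
have J_inf : has_inf [set J f | f in W].
  split; first by exists (J 0), 0.
  by exists (- c ^+ 2) => _ [f Wf <-]; exact: Jlb.
set i := inf [set J f | f in W].
have i_le f : W f -> i <= J f.
  by move=> Wf; apply: ge_inf; [exact: J_inf.2|exists f].
have /choice[u uP] (n : nat) : exists f, W f /\ J f < i + n.+1%:R^-1.
  have e0 : 0 < n.+1%:R^-1 :> R by rewrite invr_gt0.
  have [_ [f Wf <-] Jf] := inf_adherent e0 J_inf.
  by exists f.
have JD (t : R) f g : W f -> W g ->
    J (t *: g + f) = J f + 2 * t * (dot f g - L g) + t ^+ 2 * dot g g.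
  move=> Wf Wg; rewrite /J dotPl !dotPr Llin// (dotC g f); ring.
(* The parallelogram law for the quadratic functional [J], with the midpoint of [f] and [g]; it
   makes minimising sequences Cauchy. *)
have Jpar f g : W f -> W g ->
    `|f - g| ^+ 2 = 2 * J f + 2 * J g - 4 * J (2^-1 *: (g - f) + f).
  move=> Wf Wg.
  have Wgf : W (g - f) by rewrite addrC -scaleN1r; exact: Wlin.
  rewrite JD// normE.
  have -> : L (g - f) = L g - L f.
    by rewrite addrC -scaleN1r Llin// mulN1r addrC.
  rewrite /J !dotBl !dotBr (dotC g f); by field.
have ucvg : cvg (u @ \oo).
  apply/cauchy_cvgP/cauchy_exP => e e0.
  (* The midpoint has [J] at least [i], so [Jpar] bounds the squared distance by
     [2 / (n + 1) + 2 / (N + 1)]; both fractions [1 / (n + 1)] and [1 / (N + 1)] must stay below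
     [e^2 / 4]. *)
  have e4 : 0 < e ^+ 2 / 4 by rewrite divr_gt0// exprn_gt0.
  have [N _ NP] := near_infty_natSinv_lt (PosNum e4).
  exists (u N); exists N => // n Nn.
  rewrite -ball_normE /ball_ /=.
  rewrite -ltr_sqr ?nnegrE ?(ltW e0)// Jpar; [|exact: (uP _).1..].
  set w := _ + u N.
  have Ww : W w.
    apply: (Wlin); last exact: (uP _).1.
    by rewrite addrC -scaleN1r; apply: Wlin; exact: (uP _).1.
  have := i_le _ Ww; have [_] := uP N; have [_] := uP n.
  have /= := NP _ (leqnn N); have /= := NP _ Nn.
  move: (n.+1%:R^-1) (N.+1%:R^-1) (J w) => a b Jw; lra.
pose m := lim (u @ \oo).
have Wm : W m by apply: (Wcl u) => // n; exact: (uP n).1.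
exists m => // g Wg.
(* First-order optimality of [m]: since [J (t *: g + u n) >= i > J (u n) - 1 / (n + 1)], expanding
   by [JD] and letting [n] tend to infinity gives the inequality. *)
have quad (t : R) : 0 <= 2 * t * (dot m g - L g) + t ^+ 2 * dot g g.
  have h : (n.+1%:R^-1 + (2 * t * (dot (u n) g - L g) + t ^+ 2 * dot g g))
      @[n --> \oo] --> 0 + (2 * t * (dot m g - L g) + t ^+ 2 * dot g g).
    apply: cvgD; first exact: cvg_harmonic.
    apply: cvgD; last exact: cvg_cst.
    apply: cvgMr; apply: cvgB; last exact: cvg_cst.
    exact: cvg_dot.
  rewrite -[leRHS]add0r.
  rewrite -(cvg_lim (@Rhausdorff R) h); apply: limr_ge; first by apply: cvgP h.
  near=> n.
  have [Wn Jn] := uP n.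
  have := i_le _ (Wlin t _ _ Wg Wn); rewrite JD//.
  move: (n.+1%:R^-1) Jn => a; lra.
apply/eqP; rewrite -subr_eq0; apply/eqP; set x := _ - _ in quad *.
have [gg|gg] := eqVneq (dot g g) 0.
  have := quad x; have := quad (- x); rewrite gg; nra.
have gg0 : 0 < dot g g by rewrite lt_neqAle eq_sym gg -normE sqr_ge0.
(* This [t] minimises the quadratic; its minimum [- x^2 / dot g g] can be nonnegative only if
   [x = 0]. *)
have := quad (- x / dot g g).
have -> : 2 * (- x / dot g g) * x + (- x / dot g g) ^+ 2 * dot g g =
  - (x ^+ 2 / dot g g) by field.
rewrite oppr_ge0 pmulr_lle0 ?invr_gt0// => x0; apply/eqP.
by rewrite -sqrf_eq0 eq_le x0 sqr_ge0.
Unshelve. all: by end_near.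
Qed.

End Hilbert.

(** * Bounded measurable functions and mixtures *)

(** This class is stable under sums and products and integrable against every probability, so it
    discharges all integrability conditions below. *)
Definition bounded_mfun {d} {T : measurableType d} {R : realType} (f : T -> R) :=
  measurable_fun [set: T] f /\ exists M : R, forall x, `|f x| <= M.

Section BoundedMeasurable.
Context {d} {T : measurableType d} {R : realType}.
Implicit Types (f g : T -> R) (mu : {measure set T -> \bar R}).

Lemma bounded_mfunD f g : bounded_mfun f -> bounded_mfun g -> bounded_mfun (f \+ g).
Proof.
move=> [mf [M fM]] [mg [N gN]]; split; first exact: measurable_funD.
by exists (M + N) => x; rewrite (le_trans (ler_normD _ _))// lerD.
Qed.

Lemma bounded_mfunM f g : bounded_mfun f -> bounded_mfun g -> bounded_mfun (f \* g).
Proof.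
move=> [mf [M fM]] [mg [N gN]]; split; first exact: measurable_funM.
by exists (M * N) => x; rewrite normrM ler_pM.
Qed.

Lemma bounded_mfun_cst (a : R) : bounded_mfun (cst a : T -> R).
Proof. by split; [exact: measurable_cst|exists `|a|]. Qed.

Lemma bounded_mfunN f : bounded_mfun f -> bounded_mfun (\- f).
Proof.
move=> [mf [M fM]]; split; first exact: measurableT_comp.
by exists M => x; rewrite normrN.
Qed.

Lemma bounded_mfunB f g : bounded_mfun f -> bounded_mfun g -> bounded_mfun (f \- g).
Proof. by move=> ? /bounded_mfunN; exact: bounded_mfunD. Qed.

Lemma bounded_mfun_integrable mu f : (mu setT < +oo)%E -> bounded_mfun f ->
  mu.-integrable setT (EFin \o f).
Proof.
move=> muT [mf [M fM]]; apply: measurable_bounded_integrable => //.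
exists M; split; first by rewrite num_real.
by move=> N MN x _; exact: le_trans (fM x) (ltW MN).
Qed.

Lemma prob_integrable (P : probability T R) f : bounded_mfun f ->
  P.-integrable setT (EFin \o f).
Proof.
by move=> bf; apply: bounded_mfun_integrable => //; rewrite [ltLHS]probability_setT ltry.
Qed.

Lemma prob_integralE (P : probability T R) f : bounded_mfun f ->
  (\int[P]_x (f x)%:E = (\int[P]_x f x)%:E)%E.
Proof.
by move=> bf; rewrite /Rintegral fineK// integrable_fin_num//; exact: prob_integrable.
Qed.

Lemma prob_RintegralD (P : probability T R) f g : bounded_mfun f -> bounded_mfun g ->
  \int[P]_x (f x + g x) = \int[P]_x f x + \int[P]_x g x.
Proof. by move=> bf bg; rewrite RintegralD//; exact: prob_integrable. Qed.

Lemma prob_RintegralB (P : probability T R) f g : bounded_mfun f -> bounded_mfun g ->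
  \int[P]_x (f x - g x) = \int[P]_x f x - \int[P]_x g x.
Proof. by move=> bf bg; rewrite RintegralB//; exact: prob_integrable. Qed.

Lemma prob_RintegralZl (P : probability T R) (a : R) f : bounded_mfun f ->
  \int[P]_x (a * f x) = a * \int[P]_x f x.
Proof. by move=> bf; rewrite RintegralZl//; exact: prob_integrable. Qed.

Lemma prob_Rintegral_cst (P : probability T R) (a : R) : \int[P]_x a = a.
Proof. by rewrite Rintegral_cst// [X in fine X]probability_setT mulr1. Qed.

Lemma prob_Rintegral_shift (P : probability T R) f (a : R) : bounded_mfun f ->
  \int[P]_x (f x + a) = \int[P]_x f x + a.
Proof.
move=> bf; rewrite (prob_RintegralD _ bf (bounded_mfun_cst a)).
by rewrite prob_Rintegral_cst.
Qed.

Lemma prob_Rintegral_norm_le (P : probability T R) f (M : R) : bounded_mfun f ->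
  (forall x, `|f x| <= M) -> `|\int[P]_x f x| <= M.
Proof.
move=> bf fM; rewrite (le_trans (le_normr_Rintegral _ (prob_integrable P bf)))//.
rewrite -[leRHS](prob_Rintegral_cst P); apply: le_Rintegral => //.
  apply: prob_integrable; case: bf => mf _; split; first exact: measurableT_comp.
  by exists M => x; rewrite normr_id.
exact/prob_integrable/bounded_mfun_cst.
Qed.

Lemma covariance_bounded (P : probability T R) f g : bounded_mfun f -> bounded_mfun g ->
  covariance P f g
    = (\int[P]_x (f x * g x) - \int[P]_x f x * \int[P]_x g x)%:E.
Proof.
move=> bf bg; have bfg := bounded_mfunM bf bg.
have L1 h : bounded_mfun h -> h \in Lfun P 1.
  by move=> bh; apply/Lfun1_integrable; exact: prob_integrable.
rewrite covarianceE ?L1// unlock !prob_integralE//.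
Qed.

End BoundedMeasurable.

(** * Integration against mixtures of probabilities *)

Section Mixture.
Context {d} {T : measurableType d} {dO} {Om : measurableType dO} {R : realType}.
Context (P : probability Om R) (K : Om -> probability T R).
Hypothesis mK : forall A, measurable A -> measurable_fun [set: Om] (fun w => K w A).

Lemma measurable_kernel_integral (f : T -> R) : bounded_mfun f ->
  bounded_mfun (fun w => \int[K w]_x f x).
Proof.
move=> bf; have [mf [M fM]] := bf; split; last first.
  by exists M => w; exact: prob_Rintegral_norm_le.
(* The Giry integral is measurable for nonnegative integrands; adding the bound [M] makes [f]
   nonnegative and changes each integral by the constant [M]. *)
have bfM : bounded_mfun (fun x => f x + M).
  exact: (bounded_mfunD bf (bounded_mfun_cst M)).
have -> : (fun w => \int[K w]_x f x) =
    (fun w => fine (\int[K w]_x (f x + M)%:E) - M).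
  by apply/funext => w; rewrite -/(Rintegral _ _ _) prob_Rintegral_shift// addrK.
apply: measurable_funB => //; apply: measurableT_comp => //.
pose K' w : giry T R := K w.
have mK' : measurable_fun setT K' by exact: measurable_giry_codensity.
have := @measurable_giry_int _ T R (fun x => (f x + M)%:E).
move=> /(_ _ _) mi; apply: (measurableT_comp (mi _ _) mK').
  by apply/measurable_EFinP; exact: bfM.1.
by move=> x; rewrite lee_fin -lerBlDr sub0r; have := fM x; rewrite ler_norml => /andP[].
Qed.

(** On measurable sets [nu] coincides with the monadic bind of [P] with [K], and integrating against
    a bind is iterated integration. As before, [f] is first shifted by [M] to become nonnegative. *)
Lemma Rintegral_mixture (nu : {measure set T -> \bar R}) (f : T -> R) :
    (forall A, measurable A -> nu A = \int[P]_w K w A)%E ->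
    bounded_mfun f ->
  \int[nu]_x f x = \int[P]_w \int[K w]_x f x.
Proof.
move=> nuE bf; have [mf [M fM]] := bf.
have bfM : bounded_mfun (fun x => f x + M).
  exact: (bounded_mfunD bf (bounded_mfun_cst M)).
have nuT : nu setT = 1%E.
  rewrite nuE// (eq_integral (cst 1%E)); last by move=> w _; exact: probability_setT.
  by rewrite integral_cst// mul1e; exact: probability_setT.
have nuoo : (nu setT < +oo)%E by rewrite nuT ltry.
pose K' w : giry T R := K w.
have mK' : measurable_fun setT K' by exact: measurable_giry_codensity.
pose h x := (f x + M)%:E.
have mh : measurable_fun setT h by apply/measurable_EFinP; exact: bfM.1.
have h0 x : (0 <= h x)%E.
  by rewrite lee_fin -lerBlDr sub0r; have := fM x; rewrite ler_norml => /andP[].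
have e : \int[nu]_x (f x + M) = \int[P]_w \int[K w]_x (f x + M).
  rewrite /Rintegral; congr fine.
  transitivity (giry_int (giry_bind (P : giry Om R) mK') h).
    apply: eq_measure_integral => A mA _; rewrite nuE//.
    transitivity (giry_int (giry_bind (P : giry Om R) mK') (EFin \o \1_A)).
      rewrite giry_int_bind//; last by move=> x; rewrite lee_fin.
        by apply: eq_integral => w _; rewrite /giry_int/= integral_indic// setIT.
      exact/measurable_EFinP.
    by rewrite /giry_int/= integral_indic// setIT.
  rewrite giry_int_bind//; apply: eq_integral => w _.
  by rewrite /giry_int/h/= -prob_integralE.
move: e; rewrite RintegralD//; last 2 first.
- exact: bounded_mfun_integrable.
- exact/bounded_mfun_integrable/bounded_mfun_cst.
rewrite Rintegral_cst// nuT mulr1.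
under [in X in _ = X -> _]eq_Rintegral do rewrite prob_Rintegral_shift//.
rewrite prob_Rintegral_shift; first by move/addIr.
exact: measurable_kernel_integral.
Qed.

End Mixture.

(** * Random probabilities *)

Lemma prob_Rintegral_prod d d' (T : measurableType d) (T' : measurableType d')
    (R : realType) (P : probability T R) (Q : probability T' R) (f : T * T' -> R) :
  bounded_mfun f ->
  \int[(P \x Q)%E]_z f z = \int[P]_x \int[Q]_y f (x, y) /\
  \int[(P \x Q)%E]_z f z = \int[Q]_y \int[P]_x f (x, y).
Proof.
move=> bf; have [mf [M fM]] := bf.
have bf1 x : bounded_mfun (fun y => f (x, y)).
  by split; [exact: measurable_fun_pair2|exists M].
have bf2 y : bounded_mfun (fun x => f (x, y)).
  by split; [exact: measurable_fun_pair1|exists M].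
have If := prob_integrable (P \x Q)%E bf.
split; rewrite /Rintegral; congr fine.
- rewrite -(integral12_prod_meas1 If); apply: eq_integral => x _.
  by rewrite /fubini_F/= prob_integralE.
- rewrite -(integral21_prod_meas1 If); apply: eq_integral => y _.
  by rewrite /fubini_G/= prob_integralE.
Qed.

(** * Polarisation for symmetric biadditive set functions *)

Section SymmetricBiadditive.
Context d (T : measurableType d) (R : realType) (phi : set T -> set T -> R).
Hypothesis phiC : forall A B, phi A B = phi B A.
Hypothesis phiU : forall A B C, measurable A -> measurable B -> measurable C ->
  A `&` B = set0 -> phi (A `|` B) C = phi A C + phi B C.
Hypothesis phi0 : forall A, measurable A -> phi A A = 0.

(** Expanding [phi (A u B) (A u B) = 0] leaves only [2 * phi A B]. *)
Let phi_disjoint A B : measurable A -> measurable B -> A `&` B = set0 -> phi A B = 0.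
Proof.
move=> mA mB AB; have := phi0 (measurableU _ _ mA mB).
rewrite phiU ?(phiC _ (A `|` B)) ?phiU//; try exact: measurableU.
by rewrite !phi0// (phiC B A); lra.
Qed.

(* Both sets are split along [A `&` B]. *)
Lemma symmetric_biadditive_eq0 A B : measurable A -> measurable B -> phi A B = 0.
Proof.
move=> mA mB.
have split_along (A' B' C : set T) : measurable A' -> measurable B' -> measurable C ->
    A' `&` B' = set0 -> A' `&` C = set0 -> B' `&` C = set0 ->
    phi (A' `|` C) (B' `|` C) = 0.
  move=> mA' mB' mC AB AC BC; have mBC : measurable (B' `|` C) by exact: measurableU.
  rewrite phiU// 2!(phiC _ (B' `|` C)) !phiU// phi0// (phiC B' A').
  by rewrite (phiC C A') !phi_disjoint// !addr0.
have eA : A `\` B `|` A `&` B = A by rewrite setUC setUIDK.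
have eB : B `\` A `|` A `&` B = B by rewrite setUC setIC setUIDK.
rewrite -[in LHS]eA -[X in phi _ X]eB; apply: split_along.
- exact: measurableD.
- exact: measurableD.
- exact: measurableI.
all: by apply/seteqP; split => x // -[[? ?] []].
Qed.

End SymmetricBiadditive.

Section RandomProbability.
Context {R : realType} {dO : measure_display} {Omega : measurableType dO}
  {d : measure_display} {X : measurableType d}.
Implicit Types (Pt : random_probability R Omega X).

Lemma measurable_random_probability Pt (A : set X) : measurable A ->
  measurable_fun setT (fun w => (Pt w : probability X R) A).
Proof.
move=> mA.
have mPt : measurable_fun setT (Pt : Omega -> pprobability X R) by exact: measurable_funP.
exact: (measurable_kernel (kprobability mPt) A mA).
Qed.

Lemma bounded_random_mass Pt (A : set X) : measurable A ->
  bounded_mfun (random_mass Pt A).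
Proof.
move=> mA; split.
  by apply: measurableT_comp => //; exact: measurable_random_probability.
exists 1 => w; rewrite /random_mass ger0_norm ?fine_ge0//.
by rewrite -lee_fin fineK ?fin_num_measure// probability_le1.
Qed.

Lemma random_massK Pt (A : set X) (w : Omega) : measurable A ->
  ((random_mass Pt A w)%:E = (Pt w : probability X R) A)%E.
Proof. by move=> mA; rewrite /random_mass fineK// fin_num_measure. Qed.

Lemma random_massU Pt (A B : set X) (w : Omega) : measurable A -> measurable B ->
  A `&` B = set0 -> random_mass Pt (A `|` B) w = random_mass Pt A w + random_mass Pt B w.
Proof.
move=> mA mB AB; rewrite /random_mass measureU// fineD//; exact: fin_num_measure.
Qed.

Definition random_prod Pt1 Pt2 (w : Omega) : probability (X * X)%type R :=
  ((Pt1 w : probability X R) \x (Pt2 w : probability X R))%E.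

Lemma measurable_random_prod Pt1 Pt2 (C : set (X * X)) : measurable C ->
  measurable_fun setT (fun w => random_prod Pt1 Pt2 w C).
Proof.
move=> mC.
have mPt Pt : measurable_fun setT (fun w => (Pt w : probability X R) : giry X R).
  by apply: measurable_giry_codensity => // A mA; exact: measurable_random_probability.
have mprod := measurableT_comp (@measurable_giry_prod _ _ X X R)
  (measurable_fun_pair (mPt Pt1) (mPt Pt2)).
exact: (measurableT_comp (measurable_giry_ev mC) mprod).
Qed.

Lemma measurable_random_prod_giry Pt1 Pt2 :
  measurable_fun setT (fun w => random_prod Pt1 Pt2 w : giry (X * X)%type R).
Proof. by apply: measurable_giry_codensity => // C mC; exact: measurable_random_prod. Qed.

Context (P : probability Omega R).

(** The law of a pair of points drawn independently, given [w], from [Pt1 w] and [Pt2 w]. *)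
Definition joint_mean Pt1 Pt2 : giry (X * X)%type R :=
  giry_bind (P : giry Omega R) (measurable_random_prod_giry Pt1 Pt2).

Lemma joint_meanE Pt1 Pt2 (C : set (X * X)) : measurable C ->
  (joint_mean Pt1 Pt2 C = \int[P]_w random_prod Pt1 Pt2 w C)%E.
Proof.
move=> mC.
transitivity (giry_int (joint_mean Pt1 Pt2) (EFin \o \1_C)).
  by rewrite /giry_int/= integral_indic// setIT.
rewrite giry_int_bind//; last by move=> x; rewrite lee_fin.
  by apply: eq_integral => w _; rewrite /giry_int/= integral_indic// setIT.
exact/measurable_EFinP.
Qed.

Lemma joint_mean_setX Pt1 Pt2 (A B : set X) : measurable A -> measurable B ->
  (joint_mean Pt1 Pt2 (A `*` B)
    = (\int[P]_w (random_mass Pt1 A w * random_mass Pt2 B w))%:E)%E.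
Proof.
move=> mA mB; rewrite joint_meanE; last exact: measurableX.
rewrite -prob_integralE; last by apply: bounded_mfunM; exact: bounded_random_mass.
apply: eq_integral => w _.
by rewrite EFinM !random_massK// /random_prod/= product_measure1E.
Qed.

Lemma integral_joint_mean Pt1 Pt2 (f : X * X -> R) : bounded_mfun f ->
  \int[joint_mean Pt1 Pt2]_z f z = \int[P]_w \int[random_prod Pt1 Pt2 w]_z f z.
Proof.
move=> bf; apply: Rintegral_mixture => // C mC; last exact: joint_meanE.
exact: measurable_random_prod.
Qed.

End RandomProbability.

(** * The symmetrised second-moment measure of a pair of random probabilities *)

Section SecondMoments.
Context {R : realType} {dO : measure_display} {Omega : measurableType dO}
  {d : measure_display} {X : measurableType d}.
Context (P : probability Omega R) (Pt1 Pt2 : random_probability R Omega X)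
  (P0 : probability X R) (c : R).
Hypothesis mean1 : forall A, measurable A -> mean_measure P Pt1 A = P0 A.
Hypothesis mean2 : forall A, measurable A -> mean_measure P Pt2 A = P0 A.
Hypothesis c_bnd : -1 <= c <= 1.
Hypothesis cov : forall A, measurable A ->
  covariance P (random_mass Pt1 A) (random_mass Pt2 A)
    = (c * (fine (P0 A) * (1 - fine (P0 A))))%:E.

Let p (A : set X) : R := fine (P0 A).

Let m12 (A B : set X) : R := \int[P]_w (random_mass Pt1 A w * random_mass Pt2 B w).

Lemma mean_random_mass (Pt : random_probability R Omega X) (A : set X) :
  (forall A, measurable A -> mean_measure P Pt A = P0 A) -> measurable A ->
  \int[P]_w random_mass Pt A w = fine (P0 A).
Proof. by move=> mean mA; rewrite -mean// /mean_measure unlock. Qed.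

Let m12_diag A : measurable A -> m12 A A = (1 - c) * p A ^+ 2 + c * p A.
Proof.
move=> mA; have := cov mA.
rewrite covariance_bounded; [|exact: bounded_random_mass..] => -[].
rewrite !mean_random_mass// -/(m12 A A) -/(p A) => h.
by rewrite -[m12 A A](subrK (p A * p A)) h; ring.
Qed.

Let m12Ul A B C : measurable A -> measurable B -> measurable C -> A `&` B = set0 ->
  m12 (A `|` B) C = m12 A C + m12 B C.
Proof.
move=> mA mB mC AB; rewrite -prob_RintegralD; last 2 first.
- by apply: bounded_mfunM; exact: bounded_random_mass.
- by apply: bounded_mfunM; exact: bounded_random_mass.
by apply: eq_Rintegral => w _; rewrite random_massU// mulrDl.
Qed.

Let m12Ur A B C : measurable A -> measurable B -> measurable C -> A `&` B = set0 ->
  m12 C (A `|` B) = m12 C A + m12 C B.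
Proof.
move=> mA mB mC AB; rewrite -prob_RintegralD; last 2 first.
- by apply: bounded_mfunM; exact: bounded_random_mass.
- by apply: bounded_mfunM; exact: bounded_random_mass.
by apply: eq_Rintegral => w _; rewrite random_massU// mulrDr.
Qed.

Let pU A B : measurable A -> measurable B -> A `&` B = set0 -> p (A `|` B) = p A + p B.
Proof.
by move=> mA mB AB; rewrite /p measureU// fineD//; exact: fin_num_measure.
Qed.

(** The difference of the two sides is symmetric and additive in each set, and vanishes on squares
    by [m12_diag]. The sum of both orders is needed because squares do not separate [m12 A B] from
    [m12 B A]. *)
Lemma second_moment_rectangle A B : measurable A -> measurable B ->
  m12 A B + m12 B A = 2 * ((1 - c) * (p A * p B) + c * p (A `&` B)).
Proof.
move=> mA mB.
pose phi A B := m12 A B + m12 B A - 2 * ((1 - c) * (p A * p B) + c * p (A `&` B)).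
apply/eqP; rewrite -subr_eq0 -/(phi A B); apply/eqP.
apply: symmetric_biadditive_eq0 => // {A B mA mB}.
- by move=> A B; rewrite /phi [A `&` B]setIC; ring.
- move=> A B C mA mB mC AB; rewrite /phi m12Ul// m12Ur// setIUl !pU//; first ring.
  + exact: measurableI.
  + exact: measurableI.
  + by rewrite setIACA AB set0I.
- by move=> A mA; rewrite /phi m12_diag// setIid; ring.
Qed.

Let diag_measurable : measurable_fun setT (fun x : X => (x, x)).
Proof. exact: measurable_fun_pair. Qed.

Let diag : giry (X * X)%type R := giry_map diag_measurable (P0 : giry X R).

Let diag_setX A B : measurable A -> measurable B ->
  (diag (A `*` B) = (p (A `&` B))%:E)%E.
Proof.
move=> mA mB; rewrite /p fineK; last by apply: fin_num_measure; exact: measurableI.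
by congr (P0 _).
Qed.

Let c1 : 0 <= 2 * (1 - c). Proof. by case/andP: c_bnd => *; lra. Qed.
Let c2 : 0 <= 2 * (1 + c). Proof. by case/andP: c_bnd => *; lra. Qed.

(* [2 * diag] is added to both sides to keep the coefficients nonnegative. *)
Let lhs : {measure set (X * X) -> \bar R} :=
  measure_add (measure_add (joint_mean P Pt1 Pt2) (joint_mean P Pt2 Pt1))
    (measure_add diag diag).
Let rhs : {measure set (X * X) -> \bar R} :=
  measure_add (mscale (NngNum c1) (P0 \x P0)%E) (mscale (NngNum c2) diag).

Let lhsE C :
  (lhs C = joint_mean P Pt1 Pt2 C + joint_mean P Pt2 Pt1 C + (diag C + diag C))%E.
Proof.
by apply: etrans (measure_addE _ _ _) _; congr (_ + _)%E; exact: measure_addE.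
Qed.

Let rhsE C :
  (rhs C = (2 * (1 - c))%:E * (P0 \x P0) C + (2 * (1 + c))%:E * diag C)%E.
Proof. exact: measure_addE. Qed.

Let lhs_setX A B : measurable A -> measurable B -> lhs (A `*` B) = rhs (A `*` B).
Proof.
move=> mA mB.
rewrite lhsE rhsE !joint_mean_setX// !diag_setX//.
have -> : ((P0 \x P0) (A `*` B) = (p A * p B)%:E)%E.
  rewrite product_measure1E// EFinM.
  by congr (_ * _)%E; rewrite /p fineK//; exact: fin_num_measure.
rewrite -!EFinM -!EFinD; congr EFin.
have -> : \int[P]_w (random_mass Pt2 A w * random_mass Pt1 B w) = m12 B A.
  by apply: eq_Rintegral => w _; rewrite mulrC.
rewrite -/(m12 A B) second_moment_rectangle// -/(p A) -/(p B); ring.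
Qed.

Let lhs_eq C : measurable C -> lhs C = rhs C.
Proof.
pose G : set (set (X * X)) :=
  [set C | exists2 A, measurable A & exists2 B, measurable B & A `*` B = C].
(* Rectangles form a generating pi-system; both measures being finite, the constant sequence [setT]
   serves as exhaustion. *)
apply: (measure_unique G (fun=> setT)).
- by rewrite measurable_prod_measurableType.
- move=> _ _ [A1 mA1 [A2 mA2 <-]] [B1 mB1 [B2 mB2 <-]].
  exists (A1 `&` B1); first exact: measurableI.
  by exists (A2 `&` B2); [exact: measurableI|rewrite setXI].
- by move=> _; exists setT => //; exists setT => //; rewrite setXTT.
- by apply/seteqP; split => // x _; exists 0%N.
- by move=> _ [A mA [B mB <-]]; exact: lhs_setX.
- move=> _; rewrite -setXTT lhsE !joint_mean_setX// !diag_setX//.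
  by rewrite -!EFinD ltry.
Qed.

Lemma second_moment_integral (f : X * X -> R) : bounded_mfun f ->
  \int[P]_w \int[random_prod Pt1 Pt2 w]_z f z + \int[P]_w \int[random_prod Pt2 Pt1 w]_z f z
    = 2 * ((1 - c) * \int[(P0 \x P0)%E]_z f z + c * \int[P0]_x f (x, x)).
Proof.
move=> bf; have [mf [M fM]] := bf.
(* Additivity of the integral in the measure is applied to nonnegative integrands, hence the shift
   by [M]. *)
pose h z := (f z + M)%:E.
have bfM : bounded_mfun (fun z => f z + M) by exact: (bounded_mfunD bf (bounded_mfun_cst M)).
have h0 z : (0 <= h z)%E.
  by rewrite lee_fin -lerBlDr sub0r; have := fM z; rewrite ler_norml => /andP[].
have mh : measurable_fun setT h by apply/measurable_EFinP; exact: bfM.1.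
have jointE Qt1 Qt2 : (\int[joint_mean P Qt1 Qt2]_z h z =
    (\int[P]_w \int[random_prod Qt1 Qt2 w]_z f z + M)%:E)%E.
  have joint_oo : (joint_mean P Qt1 Qt2 setT < +oo)%E.
    by rewrite -setXTT joint_mean_setX// ltry.
  rewrite -prob_Rintegral_shift; last first.
    by apply: measurable_kernel_integral => //; exact: measurable_random_prod.
  under eq_Rintegral do rewrite -prob_Rintegral_shift//.
  rewrite -integral_joint_mean// fineK// integrable_fin_num//.
  exact: bounded_mfun_integrable.
have diagE : (\int[diag]_z h z = (\int[P0]_x f (x, x) + M)%:E)%E.
  have bfd : bounded_mfun (fun x => f (x, x)).
    by split; [exact: measurableT_comp|exists M].
  rewrite -prob_Rintegral_shift// -prob_integralE; last first.
    exact: (bounded_mfunD bfd (bounded_mfun_cst M)).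
  exact: (giry_int_map diag_measurable).
have prodE : (\int[(P0 \x P0)%E]_z h z = (\int[(P0 \x P0)%E]_z f z + M)%:E)%E.
  by rewrite prob_integralE// prob_Rintegral_shift.
have : (\int[lhs]_z h z = \int[rhs]_z h z)%E.
  by apply: eq_measure_integral => C mC _; exact: lhs_eq.
rewrite /lhs /rhs !ge0_integral_measure_add//; try by move=> z _; exact: h0.
rewrite !ge0_integral_mscale// !jointE diagE prodE -!EFinM -!EFinD => -[].
set a1 := \int[P]_w _; set a2 := \int[P]_w _; set b := Rintegral _ _ f.
set e := \int[P0]_x _ => sumE.
(* What has to be removed: [lhs] has total mass 4, which accounts for [4 * M], and its two copies of
   [diag] contribute [2 * e]. *)
have -> : a1 + a2 = a1 + M + (a2 + M) + (e + M + (e + M)) - (2 * e + 4 * M) by ring.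
rewrite sumE /=; ring.
Qed.

End SecondMoments.

(** * Kernel mean embeddings *)

Section RkhsBoundedKernel.
Context {R : realType} {d : measure_display} {X : measurableType d}
  {k : X -> X -> R} (H : rkhs k).
Hypothesis kP : is_kernel k.

Local Notation "<< f , g >>" := (rkhs_dot H f g).
Local Notation phi := (rkhs_feature H).
Local Notation mu := (mean_embedding H).

Lemma bounded_kernel2 : bounded_mfun (fun z : X * X => k z.1 z.2).
Proof. by case: kP => mk [M kM] _ _; split => //; exists M => z. Qed.

Lemma bounded_kernel_diag : bounded_mfun (fun x => k x x).
Proof.
have [mk [M kM]] := bounded_kernel2; split; last by exists M => x; exact: (kM (x, x)).
have mdiag : measurable_fun setT (fun x : X => (x, x)) by exact: measurable_fun_pair.
exact: (measurableT_comp mk mdiag).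
Qed.

Lemma rkhs_fun_feature x y : rkhs_fun (phi x) y = k x y.
Proof. by rewrite rkhs_featureE. Qed.

Lemma dot_feature_feature x y : << phi x, phi y >> = k x y.
Proof. by rewrite rkhs_reproducing rkhs_fun_feature. Qed.

(** Cauchy-Schwarz against the feature at [x], whose norm is the square root of [k x x]. Norm
    convergence thus dominates uniform convergence. *)
Lemma rkhs_fun_bounded : exists c : R, forall (f : H) x,
   `|rkhs_fun f x| <= c * `|f|.
Proof.
case: kP => _ [M kM] _ _; exists (Num.sqrt M) => f x; rewrite -rkhs_reproducing mulrC.
apply: le_trans (dot_norm_le (@rkhs_normE _ _ _ H) _ _) _; apply: ler_wpM2l => //.
rewrite -[leLHS]ger0_norm// -sqrtr_sqr ler_wsqrtr// rkhs_normE dot_feature_feature.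
exact: le_trans (ler_norm _) (kM x x).
Qed.

Lemma rkhs_ext (f g : H) : (forall x, rkhs_fun f x = rkhs_fun g x) -> f = g.
Proof. by move=> fg; apply: rkhs_fun_inj; apply/funext. Qed.

Lemma rkhs_dot_ext (f g : H) : (forall h, << h, f >> = << h, g >>) -> f = g.
Proof.
move=> fg; apply: rkhs_ext => x.
by rewrite -!rkhs_reproducing dotC fg dotC.
Qed.

(** The members of [H] are not measurable by definition, so Riesz representation is first applied on
    this subspace. *)
Let W : set H := [set f | measurable_fun setT (rkhs_fun f)].

Let rkhs_fun0 x : rkhs_fun (0 : H) x = 0.
Proof. by rewrite -rkhs_reproducing dotC dot0r. Qed.

Let W0 : W 0.
Proof. by rewrite /W/= (_ : rkhs_fun _ = cst 0)//; apply/funext => x; rewrite rkhs_fun0. Qed.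

Let Wlin (a : R) f g : W f -> W g -> W (a *: f + g).
Proof.
move=> Wf Wg; rewrite /W/=.
rewrite (_ : rkhs_fun _ = (fun x => a * rkhs_fun f x) \+ rkhs_fun g); last first.
  by apply/funext => x; rewrite rkhs_fun_linear.
by apply: measurable_realfun.measurable_funD => //; exact: measurable_funM.
Qed.

(** By the reproducing property norm limits are pointwise limits, and these preserve
    measurability. *)
Let Wcl (u : nat -> H) l : (forall n, W (u n)) -> u @ \oo --> l -> W l.
Proof.
move=> Wu ul; apply: (@measurable_fun_cvg _ _ _ _ (fun n => rkhs_fun (u n))) => //.
move=> x _; rewrite -rkhs_reproducing.
under eq_fun do rewrite -rkhs_reproducing.
exact: (cvg_dot (@rkhs_normE _ _ _ H)).
Qed.

Let Wfeature x : W (phi x).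
Proof.
rewrite /W/= rkhs_featureE.
by have [mk _] := bounded_kernel2; exact: (measurable_fun_pair2 x mk).
Qed.

(* The features span a dense subspace: the orthogonal projection of [f] on the
   space of measurable members of [H] has the same point values as [f]. *)
Lemma measurable_rkhs_fun (f : H) : measurable_fun setT (rkhs_fun f).
Proof.
have [||m Wm mE] := riesz_subspace (@rkhs_normE _ _ _ H)
  (L := fun g => << f, g >>) (c := `|f|) W0 Wlin Wcl.
- by move=> a g h _ _; rewrite dotPr.
- by move=> g _; exact: (dot_norm_le (@rkhs_normE _ _ _ H)).
suff -> : f = m by [].
by apply: rkhs_ext => x; rewrite -!rkhs_reproducing mE.
Qed.

Lemma bounded_rkhs_fun (f : H) : bounded_mfun (rkhs_fun f).
Proof.
split; first exact: measurable_rkhs_fun.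
by have [c cP] := rkhs_fun_bounded; exists (c * `|f|).
Qed.

(** Integration against [Q] is a bounded linear functional on [H]; the value at [y] of its
    representer is the integral of the feature at [y]. *)
Lemma dot_mean_embedding (Q : probability X R) (f : H) :
  << f, mu Q >> = \int[Q]_x rkhs_fun f x.
Proof.
have [c cP] := rkhs_fun_bounded.
have [||m _ mE] := riesz_subspace (@rkhs_normE _ _ _ H)
  (L := fun g => \int[Q]_x rkhs_fun g x) (c := c) W0 Wlin Wcl.
- move=> a g h _ _; under eq_Rintegral do rewrite rkhs_fun_linear.
  rewrite prob_RintegralD ?prob_RintegralZl//; try exact: bounded_rkhs_fun.
  exact: (bounded_mfunM (bounded_mfun_cst a) (bounded_rkhs_fun g)).
- by move=> g _; apply: prob_Rintegral_norm_le; [exact: bounded_rkhs_fun|exact: cP].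
have kC x y : k x y = k y x by case: kP.
have mP y : rkhs_fun m y = \int[Q]_x k x y.
  rewrite -rkhs_reproducing mE; last exact: Wfeature.
  by apply: eq_Rintegral => x _; rewrite rkhs_fun_feature kC.
(* The representer satisfies the defining condition of [mean_embedding], so the default value 0 is
   not what [xget] returns. *)
have -> : mu Q = m.
  apply: xget_unique => // m' m'P.
  by apply: rkhs_ext => x; rewrite m'P mP.
by rewrite dotC mE//; exact: measurable_rkhs_fun.
Qed.

Lemma rkhs_fun_mean_embedding (Q : probability X R) y :
  rkhs_fun (mu Q) y = \int[Q]_x k x y.
Proof.
rewrite -rkhs_reproducing dotC dot_mean_embedding.
by apply: eq_Rintegral => x _; rewrite rkhs_fun_feature; case: kP.
Qed.

Lemma dot_mean_embedding2 (Q1 Q2 : probability X R) :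
  << mu Q1, mu Q2 >> = \int[(Q1 \x Q2)%E]_z k z.1 z.2.
Proof.
rewrite dot_mean_embedding (prob_Rintegral_prod _ _ bounded_kernel2).2.
by apply: eq_Rintegral => y _; rewrite rkhs_fun_mean_embedding.
Qed.

(** * Mean and covariance of random mean embeddings *)

Section Moments.
Context {dO : measure_display} {Omega : measurableType dO}
  (P : probability Omega R) (P0 : probability X R).
Implicit Types (Pt : random_probability R Omega X).

Lemma Rintegral_random_probability Pt (f : X -> R) :
    (forall A, measurable A -> mean_measure P Pt A = P0 A) -> bounded_mfun f ->
  \int[P]_w \int[(Pt w : probability X R)]_x f x = \int[P0]_x f x.
Proof.
move=> mean bf; apply/esym; apply: Rintegral_mixture => // A mA.
  exact: measurable_random_probability.
apply: etrans (esym (mean A mA)) _; rewrite /mean_measure unlock; apply: eq_integral => w _.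
exact: random_massK.
Qed.

Lemma bounded_dot_random_embedding Pt (h : H) :
  bounded_mfun (fun w => << h, mu (Pt w) >>).
Proof.
under eq_fun do rewrite dot_mean_embedding.
apply: measurable_kernel_integral; last exact: bounded_rkhs_fun.
by move=> A; exact: measurable_random_probability.
Qed.

Lemma mean_dot_random_embedding Pt (h : H) :
    (forall A, measurable A -> mean_measure P Pt A = P0 A) ->
  \int[P]_w << h, mu (Pt w) >> = << h, mu P0 >>.
Proof.
move=> mean; under eq_Rintegral do rewrite dot_mean_embedding.
rewrite Rintegral_random_probability ?dot_mean_embedding//.
exact: bounded_rkhs_fun.
Qed.

(** Tested against [h], the claim says that the integral of [h] against [Pt] has as its mean the
    integral of [h] against [P0]; uniqueness is [rkhs_dot_ext]. *)
Lemma hilbert_mean_random_embedding Pt :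
    (forall A, measurable A -> mean_measure P Pt A = P0 A) ->
  hilbert_mean P (fun w => mu (Pt w)) = mu P0.
Proof.
move=> mean; apply: xget_unique => [h|m mP].
  rewrite unlock prob_integralE; last exact: bounded_dot_random_embedding.
  by rewrite mean_dot_random_embedding.
apply: rkhs_dot_ext => h; have := mP h.
rewrite unlock prob_integralE; last exact: bounded_dot_random_embedding.
by rewrite mean_dot_random_embedding// => -[].
Qed.

Lemma bounded_dot_random_embedding2 Pt1 Pt2 :
  bounded_mfun (fun w => << mu (Pt1 w), mu (Pt2 w) >>).
Proof.
under eq_fun do rewrite dot_mean_embedding2.
apply: (measurable_kernel_integral (K := random_prod Pt1 Pt2)).
  by move=> C; exact: measurable_random_prod.
exact: bounded_kernel2.
Qed.

(** The variance in [H] of the feature of a random point with law [P0]; it is the common factor that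
    cancels in the correlation. *)
Definition kernel_spread : R := \int[P0]_x k x x - << mu P0, mu P0 >>.

(** Covers variances too: [c] is [eta] for the pair, and [lambda1] or [lambda2] when both arguments
    are the same random probability. *)
Lemma kernel_covE Pt1 Pt2 (c : R) :
    (forall A, measurable A -> mean_measure P Pt1 A = P0 A) ->
    (forall A, measurable A -> mean_measure P Pt2 A = P0 A) ->
    -1 <= c <= 1 ->
    (forall A, measurable A ->
      covariance P (random_mass Pt1 A) (random_mass Pt2 A)
        = (c * (fine (P0 A) * (1 - fine (P0 A))))%:E) ->
  kernel_cov H P Pt1 Pt2 = c * kernel_spread.
Proof.
move=> mean1 mean2 cbnd cov.
rewrite /kernel_cov !hilbert_mean_random_embedding// unlock -/(Rintegral _ _ _).
set m := mu P0.
have -> : \int[P]_w << mu (Pt1 w) - m, mu (Pt2 w) - m >> =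
    \int[P]_w << mu (Pt1 w), mu (Pt2 w) >> - << m, m >>.
  transitivity (\int[P]_w ((<< mu (Pt1 w), mu (Pt2 w) >> - << m, mu (Pt1 w) >>)
      - << m, mu (Pt2 w) >> + << m, m >>)).
    apply: eq_Rintegral => w _.
    by rewrite dotBl !dotBr (dotC _ (mu (Pt1 w)) m); ring.
  have b12 := bounded_dot_random_embedding2 Pt1 Pt2.
  have b1 := bounded_dot_random_embedding Pt1 m.
  have b2 := bounded_dot_random_embedding Pt2 m.
  rewrite prob_Rintegral_shift; last exact: (bounded_mfunB (bounded_mfunB b12 b1) b2).
  rewrite (prob_RintegralB _ (bounded_mfunB b12 b1) b2) (prob_RintegralB _ b12 b1).
  by rewrite !mean_dot_random_embedding//; ring.
have := second_moment_integral mean1 mean2 cbnd cov bounded_kernel2.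
have jointE Qt1 Qt2 : \int[P]_w \int[random_prod Qt1 Qt2 w]_z k z.1 z.2 =
    \int[P]_w << mu (Qt1 w), mu (Qt2 w) >>.
  by apply: eq_Rintegral => w _; rewrite dot_mean_embedding2.
rewrite !jointE.
have -> : \int[P]_w << mu (Pt2 w), mu (Pt1 w) >> =
    \int[P]_w << mu (Pt1 w), mu (Pt2 w) >>.
  by apply: eq_Rintegral => w _; rewrite dotC.
rewrite -dot_mean_embedding2 /kernel_spread -/m /=.
set a := Rintegral _ _ _; set b := Rintegral _ _ _ => h.
(* Symmetry of the inner product made both mixed terms equal, so the symmetrised identity [h]
   determines [a]. *)
have -> : a = (a + a) / 2 by field.
by rewrite h; field.
Qed.

Lemma kernel_spreadE :
  kernel_spread = \int[P0]_x (`|phi x - mu P0| ^+ 2).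
Proof.
transitivity (\int[P0]_x (k x x - 2 * rkhs_fun (mu P0) x + << mu P0, mu P0 >>)).
  have b1 := bounded_kernel_diag.
  have b2 := bounded_mfunM (bounded_mfun_cst 2) (bounded_rkhs_fun (mu P0)).
  rewrite prob_Rintegral_shift; last exact: (bounded_mfunB b1 b2).
  rewrite (prob_RintegralB _ b1 b2) prob_RintegralZl; last exact: bounded_rkhs_fun.
  by rewrite -dot_mean_embedding /kernel_spread; ring.
apply: eq_Rintegral => x _; rewrite rkhs_normE dotBl !dotBr dot_feature_feature.
by rewrite (dotC _ (phi x)) rkhs_reproducing; ring.
Qed.

End Moments.

End RkhsBoundedKernel.

(** * Degenerate cases and positivity of the kernel variance *)

Lemma prob_Rintegral_eq0 d (T : measurableType d) (R : realType) (P : probability T R)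
    (f : T -> R) : bounded_mfun f -> (forall x, 0 <= f x) -> \int[P]_x f x = 0 ->
  \forall x \ae P, f x = 0.
Proof.
move=> bf f0 If.
have mf : measurable_fun setT (EFin \o f) by apply/measurable_EFinP; exact: bf.1.
have : (\int[P]_x `|(EFin \o f) x| = 0)%E.
  transitivity (\int[P]_x (f x)%:E)%E; last by rewrite prob_integralE// If.
  by apply: eq_integral => x _; rewrite /= ger0_norm.
move/(ae_eq_integral_abs P measurableT mf); by apply: filterS => x /(_ I) [].
Qed.

Lemma variance0_deterministic_rv d (T : measurableType d) (R : realType)
    (P : probability T R) (f : T -> R) : bounded_mfun f -> 'V_P[f]%E = 0%E ->
  deterministic_rv P f.
Proof.
move=> bf; rewrite /variance unlock; set a := fine _ => Vf.
exists a; have bfa : bounded_mfun (f \- cst a).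
  exact: bounded_mfunB bf (bounded_mfun_cst a).
have := @prob_Rintegral_eq0 _ _ _ P _ (bounded_mfunM bfa bfa).
have -> : \int[P]_x (((f \- cst a) \* (f \- cst a)) x) = 0.
  by move: Vf; rewrite unlock /Rintegral => ->.
have sq0 x : 0 <= ((f \- cst a) \* (f \- cst a)) x by rewrite /= -expr2 sqr_ge0.
move=> /(_ sq0 erefl); apply: filterS => x /= /eqP.
by rewrite mulf_eq0 orbb subr_eq0 => /eqP.
Qed.

(** Serves both correlations: [s] is [kernel_spread] for the kernel one and [P0(A) (1 - P0(A))] for
    the real one. *)
Lemma corr_ratio (R : rcfType) (s e l1 l2 : R) : 0 < s -> 0 < l1 -> 0 < l2 ->
  e * s / (Num.sqrt (l1 * s) * Num.sqrt (l2 * s)) = e / Num.sqrt (l1 * l2).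
Proof.
move=> s0 l10 l20; rewrite !sqrtrM ?ltW// mulrACA -expr2 sqr_sqrtr ?ltW//.
by rewrite invfM mulrACA -mulrA divff ?gt_eqF// mulr1.
Qed.

Section Positivity.
Context {R : realType} {d : measure_display} {X : measurableType d}
  {k : X -> X -> R} (H : rkhs k).
Hypotheses (kP : is_kernel k) (k_inj : injective k).
Context {dO : measure_display} {Omega : measurableType dO}
  (P : probability Omega R) (P0 : probability X R) (Pt : random_probability R Omega X).
Hypothesis mean : forall A, measurable A -> mean_measure P Pt A = P0 A.

(** The mass of the point is at most 1 and has mean 1, so it is almost surely 1, and [Pt] is almost
    surely the Dirac mass there. *)
Lemma random_mass1_deterministic (x0 : X) : measurable [set x0] ->
  P0 [set x0] = 1%E -> deterministic_measure P Pt.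
Proof.
move=> mx0 P0x0; exists (\d_x0 : probability X R).
have b1 := bounded_random_mass Pt mx0.
have b0 := bounded_mfunB (bounded_mfun_cst 1) b1.
have /prob_Rintegral_eq0 : \int[P]_w ((cst 1 \- random_mass Pt [set x0]) w) = 0.
  rewrite (prob_RintegralB _ (bounded_mfun_cst 1) b1) prob_Rintegral_cst.
  by rewrite (mean_random_mass mean mx0) P0x0 /= subrr.
move=> /(_ b0) mass1; have : \forall w \ae P, (cst 1 \- random_mass Pt [set x0]) w = 0.
  apply: mass1 => w; rewrite /= subr_ge0 -lee_fin random_massK//.
  exact: probability_le1.
apply: filterS => w /eqP; rewrite /= subr_eq0 => /eqP m1 A mA.
have Ptx0 : (Pt w : probability X R) [set x0] = 1%E by rewrite -random_massK// -m1.
have one_of (B : set X) : measurable B -> B x0 -> (Pt w : probability X R) B = 1%E.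
  move=> mB Bx0; apply/eqP; rewrite eq_le probability_le1//= -Ptx0.
  by apply: le_measure; rewrite ?inE// => _ ->.
rewrite diracE; have [/set_mem Ax0|/negP Ax0] := boolP (x0 \in A).
  by rewrite one_of.
have nAx0 : (~` A) x0 by move=> Ax; apply: Ax0; exact: mem_set.
have := probability_setC (Pt w : probability X R) (measurableC mA).
by rewrite setCK (one_of _ (measurableC mA) nAx0) subee.
Qed.

(** If the spread vanished, the feature map would equal [m] almost everywhere for [P0]; injectivity
    leaves room for a single point, which then carries all the mass. *)
Lemma kernel_spread_gt0 : ~ deterministic_measure P Pt -> 0 < kernel_spread H P0.
Proof.
move=> nondet; rewrite lt_neqAle kernel_spreadE// Rintegral_ge0 ?andbT; last first.
  by move=> x _; exact: sqr_ge0.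
apply/eqP => /esym spread0; apply: nondet.
set m := mean_embedding H P0 in spread0.
pose g x : R := `|rkhs_feature H x - m| ^+ 2.
have bg : bounded_mfun g.
  have -> : g = ((fun x => k x x) \- (cst 2 \* rkhs_fun m)) \+ cst (rkhs_dot H m m).
    apply/funext => x; rewrite /g rkhs_normE dotBl !dotBr dot_feature_feature.
    by rewrite (dotC _ (rkhs_feature H x)) rkhs_reproducing /=; ring.
  apply: bounded_mfunD (bounded_mfun_cst _).
  apply: bounded_mfunB; first exact: bounded_kernel_diag.
  by apply: bounded_mfunM (bounded_mfun_cst 2) _; exact: bounded_rkhs_fun.
have g0 x : 0 <= g x by exact: sqr_ge0.
have [N [mN PN gN]] := prob_Rintegral_eq0 bg g0 spread0.
have mg0 : measurable [set x | g x = 0].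
  by rewrite -[X in measurable X]setTI; exact: (bg.1 measurableT _ (measurable_set1 0)).
have Pg0 : P0 [set x | g x = 0] = 1%E.
  apply/eqP; rewrite eq_le probability_le1//=.
  have PNC : (P0 (~` N) = 1)%E by rewrite probability_setC// PN sube0.
  rewrite -PNC; apply: le_measure; rewrite ?inE//; first exact: measurableC.
  by move=> x Nx; apply: contrapT => gx; exact/Nx/gN.
have [x0 gx0] : [set x | g x = 0] !=set0.
  by apply/set0P/eqP => g00; move: Pg0; rewrite g00 measure0 => /eqP;
    rewrite eqe eq_sym oner_eq0.
have feature_eq x : g x = 0 -> rkhs_feature H x = m.
  by move=> /eqP; rewrite sqrf_eq0 normr_eq0 subr_eq0 => /eqP.
(* Besides locating the mass, this identity makes the singleton measurable, as the zero set of the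
   measurable [g]. *)
have g0E : [set x | g x = 0] = [set x0].
  apply/seteqP; split => [x /= gx|_ -> //]; apply: k_inj.
  by rewrite -!(rkhs_featureE H) !feature_eq.
by apply: (@random_mass1_deterministic x0); rewrite -g0E.
Qed.

End Positivity.

Theorem theorem13 (R : realType) (T : ptopologicalType)
  (T_polish : polish R T) (T_lcpt : locally_compact [set: T])
  (dO : measure_display) (Omega : measurableType dO)
  (P : probability Omega R)
  (Pt1 Pt2 : random_probability R Omega (borel T))
  (Pt1_nondet : ~ deterministic_measure P Pt1)
  (Pt2_nondet : ~ deterministic_measure P Pt2)
  (P0 : probability (borel T) R)
  (mean1 : forall A : set (borel T), measurable A -> mean_measure P Pt1 A = P0 A)
  (mean2 : forall A : set (borel T), measurable A -> mean_measure P Pt2 A = P0 A)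
  (eta lambda1 lambda2 : R)
  (eta_bnd : -1 <= eta <= 1)
  (lambda1_bnd : 0 < lambda1 <= 1) (lambda2_bnd : 0 < lambda2 <= 1)
  (cov12 : forall A : set (borel T), measurable A ->
     covariance P (random_mass Pt1 A) (random_mass Pt2 A)
       = (eta * (fine (P0 A) * (1 - fine (P0 A))))%:E)
  (var1 : forall A : set (borel T), measurable A ->
     ('V_P[random_mass Pt1 A] = (lambda1 * (fine (P0 A) * (1 - fine (P0 A))))%:E)%E)
  (var2 : forall A : set (borel T), measurable A ->
     ('V_P[random_mass Pt2 A] = (lambda2 * (fine (P0 A) * (1 - fine (P0 A))))%:E)%E) :
  forall k : borel T -> borel T -> R, injective_kernel k ->
  forall H : rkhs k,
    0 < kernel_var H P Pt1 /\ 0 < kernel_var H P Pt2 /\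
    forall A : set (borel T), measurable A ->
      ~ deterministic_rv P (random_mass Pt1 A) ->
      ~ deterministic_rv P (random_mass Pt2 A) ->
      kernel_corr H P Pt1 Pt2
        = correlation P (random_mass Pt1 A) (random_mass Pt2 A) /\
      correlation P (random_mass Pt1 A) (random_mass Pt2 A)
        = eta / Num.sqrt (lambda1 * lambda2).
Proof.
move=> k [kP k_inj] H.
have [l1_gt0 l1_le1] := andP lambda1_bnd; have [l2_gt0 l2_le1] := andP lambda2_bnd.
have spread_gt0 := kernel_spread_gt0 H kP k_inj mean1 Pt1_nondet.
have l_bnd (l : R) : 0 < l -> l <= 1 -> -1 <= l <= 1.
  by move=> l0 l1; rewrite l1 andbT (le_trans _ (ltW l0))// lerN10.
have kcov := kernel_covE H kP mean1 mean2 eta_bnd cov12.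
have kvar1 : kernel_var H P Pt1 = lambda1 * kernel_spread H P0.
  by rewrite /kernel_var; apply: (kernel_covE H kP mean1 mean1 (l_bnd _ l1_gt0 l1_le1)) => A mA;
    exact: var1.
have kvar2 : kernel_var H P Pt2 = lambda2 * kernel_spread H P0.
  by rewrite /kernel_var; apply: (kernel_covE H kP mean2 mean2 (l_bnd _ l2_gt0 l2_le1)) => A mA;
    exact: var2.
rewrite /kernel_corr kvar1 kvar2 kcov !mulr_gt0//; split=> //; split=> // A mA nd1 _.
suff -> : correlation P (random_mass Pt1 A) (random_mass Pt2 A)
    = eta / Num.sqrt (lambda1 * lambda2) by rewrite corr_ratio.
rewrite /correlation cov12// var1// var2//= corr_ratio//.
have P0A_ge0 : 0 <= fine (P0 A) by exact: fine_ge0.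
have P0A_le1 : fine (P0 A) <= 1.
  by rewrite -lee_fin fineK ?fin_num_measure// probability_le1.
(* If [P0(A) (1 - P0(A))] were 0, the variance of the mass of [A] under [Pt1] would be 0 and that
   mass deterministic. *)
rewrite lt_neqAle mulr_ge0 ?subr_ge0// andbT; apply/eqP => /esym s0; apply: nd1.
apply: variance0_deterministic_rv; first exact: bounded_random_mass.
by rewrite var1// s0 mulr0.
Qed.
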